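(* For every frequency interval $[a,b]\subset\mathbb{R}$ with $a<b$, the ideal analog filter $L_{[a,b]}$ forms with the space $\mathbf{CF_a}$ of analog causal filters an angle equal to $\pi/4$. Moreover, the distance $d=d(L_{[a,b]},\mathbf{CF_a})$ is $d=\sqrt{\frac{b-a}{2}}=\frac{1}{\sqrt{2}}\|L_{[a,b]}\|$.
   Context: Signals are complex valued. The Fourier transform $\mathcal{F}:L^2(\mathbb{R})\to L^2(\mathbb{R})$ is the unitary operator given by $\mathcal{F}(x)(w)=\frac{1}{\sqrt{2\pi}}\int_{-\infty}^{\infty}x(t)e^{-iwt}\,dt$, with inverse $\mathcal{F}^{-1}(x)(t)=\frac{1}{\sqrt{2\pi}}\int_{-\infty}^{\infty}x(w)e^{iwt}\,dw$. $\mathbf{F_a}$ is the normed space (with the operator norm) of analog filters, i.e. bounded linear operators $L:L^2(\mathbb{R})\to L^\infty(\mathbb{R})$ commuting with all translations. Every $L\in\mathbf{F_a}$ is of the form $L=L_h$ for a unique $h\in L^2(\mathbb{R})$, where $L_h(x)=x*h$, $(x*h)(t)=\int_{-\infty}^{\infty}x(s)h(t-s)\,ds$; moreover $\|L_h\|=\|h\|_{L^2}$, and $\mathbf{F_a}$ is a Hilbert space with $\langle L_h,L_g\rangle=\langle h,g\rangle_{L^2}$. The transfer function of $L_h$ is $H=\mathcal{F}(h)$. $\mathbf{CF_a}$ (the causal filters) is the set of all $L_h$, $h\in L^2(\mathbb{R})$, with $h=0$ a.e. on $(-\infty,0)$. The ideal filter $L_{[a,b]}$ is the analog filter with transfer function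 $\chi_{[a,b]}$ (the indicator function of $[a,b]$), i.e. $L_{[a,b]}=L_h$ with $h=\mathcal{F}^{-1}(\chi_{[a,b]})$. The distance is $d(L,M)=\inf_{K\in M}\|L-K\|$, and the angle determined by a nonzero filter $L$ and a closed subspace $M$ is $\arcsin\big(d(L,M)/\|L\|\big)\in[0,\pi/2]$. *)

(* Defs.v *)
From HB Require Import structures.
From mathcomp Require Import all_boot all_order all_algebra.
From mathcomp Require Import complex.
From mathcomp Require Import all_classical all_reals all_analysis.

Set Implicit Arguments.
Unset Strict Implicit.
Unset Printing Implicit Defensive.

Import Order.TTheory GRing.Theory Num.Theory.
Import numFieldNormedType.Exports.

Local Open Scope classical_set_scope.
Local Open Scope ring_scope.
Local Open Scope complex_scope.

Section Filters.
Context {R : realType}.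

Local Notation mu := (@lebesgue_measure R).

Definition signal := R -> R[i].

Definition cmeasurable (x : signal) : Prop :=
  measurable_fun [set: R] (fun t => complex.Re (x t)) /\
  measurable_fun [set: R] (fun t => complex.Im (x t)).

Definition Lp_norm (p : \bar R) (x : signal) : \bar R :=
  Lnorm mu p (fun t => (Normc.normc (x t))%:E).

(** Elements of [Lp p] are representatives: equality in [L^p] is [%[ae mu]]. *)
Definition Lp (p : \bar R) : set signal :=
  [set x | cmeasurable x /\ (Lp_norm p x < +oo)%E].

Local Notation L2 := (Lp 2%:E).
Local Notation Linf := (Lp +oo%E).

(** Meaningful when the real and imaginary parts of [x] are integrable on [D]
    (the real integral is totalized). *)
Definition cintegral (D : set R) (x : signal) : R[i] :=
  (\int[mu]_(t in D) complex.Re (x t)) +i* (\int[mu]_(t in D) complex.Im (x t)).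

(** [cexpi u] is e^{iu}. *)
Definition cexpi (u : R) : R[i] := cos u +i* sin u.

(** The inverse Fourier transform, given by its integral formula on
    [L^1 \cap L^2]; it is only applied to indicators of bounded intervals. *)
Definition inv_fourier (X : signal) : signal := fun t =>
  (Num.sqrt (2 * pi))^-1%:C * cintegral setT (fun w => X w * cexpi (w * t)).

Definition conv (x h : signal) : signal := fun t =>
  cintegral setT (fun s => x s * h (t - s)).

Definition translate (s : R) (x : signal) : signal := fun t => x (t - s).

(** Operators between the function spaces act on representatives; their values
    outside [L2] are irrelevant. *)
Definition operator := signal -> signal.

(** The norm of bounded linear operators from [L2] to [Linf]. *)
Definition op_norm (L : operator) : \bar R :=
  ereal_sup [set Lp_norm +oo%E (L x) | x in [set x | L2 x /\
                                              (Lp_norm 2%:E x <= 1)%E]].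

(** Compatibility with a.e. equality need not be required: it follows from
    linearity and boundedness. *)
Record analog_filter (L : operator) : Prop := AnalogFilter {
  filter_range : forall x, L2 x -> Linf (L x) ;
  filter_linear : forall (c : R[i]) x y, L2 x -> L2 y ->
    \forall t \ae mu, L (fun u => c * x u + y u) t = c * L x t + L y t ;
  filter_bounded : exists C : R, forall x, L2 x ->
    (Lp_norm +oo%E (L x) <= C%:E * Lp_norm 2%:E x)%E ;
  filter_translate : forall s x, L2 x ->
    \forall t \ae mu, L (translate s x) t = translate s (L x) t }.

(** The operator [L_h]. *)
Definition conv_filter (h : signal) : operator := fun x => conv x h.

(** Equality of operators from [L2] to [Linf]. *)
Definition operator_eq (L K : operator) : Prop :=
  forall x, L2 x -> \forall t \ae mu, L x t = K x t.

Definition causal_filters : set operator :=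
  [set L | analog_filter L /\ exists h : signal,
     [/\ L2 h, \forall t \ae mu, t < 0 -> h t = 0
       & operator_eq L (conv_filter h)]].

Definition ideal_filter (a b : R) : operator :=
  conv_filter (inv_fourier (fun w => (\1_`[a, b] w)%:C)).

Definition dist (L : operator) (M : set operator) : \bar R :=
  ereal_inf [set op_norm (fun x t => L x t - K x t) | K in M].

(** For [op_norm L] finite and nonzero, and [dist L M] finite. *)
Definition angle (L : operator) (M : set operator) : R :=
  asin (fine (dist L M) / fine (op_norm L)).

End Filters.

(* Main.v *)
Require Import Defs.
From mathcomp Require Import all_boot all_order all_algebra.
From mathcomp Require Import complex ring lra.
From mathcomp Require Import all_classical all_reals all_analysis.
From mathcomp Require Import measurable_realfun ess_sup_inf.

(** Write [h] for the impulse response of the ideal filter, so that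
    [h t = (sqrt (2 pi))^-1 * \int_a^b e^{iwt} dw].  Convolution with a square
    integrable [k] is an operator of norm at most [||k||_2], by Cauchy-Schwarz.
    Cutting [h] at time 0 gives a causal [g] with [h - g] equal to [h] on the
    negative half-line and to 0 elsewhere, so the distance to the causal filters
    is at most the square root of [\int_{t < 0} |h t|^2].

    For the converse, let [K] be causal and feed the filters the truncated
    matched input [x s = conj (h (- s)) / r] for [s] in [[0, n]], and [x s = 0]
    elsewhere, where [r] makes the norm of [x] equal to 1.  At times [t < 0] the
    output of the causal [K] still vanishes; hence there [L x - K x] is the
    convolution [x * h], whose value tends as [t] goes to 0 to [r], the square
    root of [\int_0^n |h (- s)|^2 ds] ([op_norm_ge]).  Letting [n] grow, the
    distance is exactly the square root of the negative-time energy of [h].  The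
    same input on [[- n, n]] gives [||L|| = ||h||_2].

    What remains is the value of the two energies.  A computation yields
    [|h t|^2 t^2 = (2 / pi) sin^2 ((b - a) t / 2)] ([sqr_ideal_response]),
    which is even in [t]: half of the energy lies on each side of 0, wherever
    the frequency interval is.  The integral of [sin^2 (c s) / s^2] over the
    positive half-line is [c pi / 2] ([integral_sinc2]), so each half equals
    [(b - a) / 2].  The ratio of distance to norm is then [1 / sqrt 2], the sine
    of [pi / 4].

    The sinc-square integral is obtained from the Fejer kernel
    [F_n x = sin^2 (n x) / sin^2 x]: this trigonometric polynomial has integral
    [n pi / 2] over [[0, pi / 2]], and it differs from [sin^2 (n x) / x^2] by at
    most 1 there because [cos^2 x / sin^2 x <= 1 / x^2 <= 1 / sin^2 x]. *)

Set Implicit Arguments.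
Unset Strict Implicit.
Unset Printing Implicit Defensive.

Import Order.TTheory GRing.Theory Num.Theory.
Import numFieldNormedType.Exports.

Local Open Scope classical_set_scope.
Local Open Scope ring_scope.
Local Open Scope complex_scope.

(** * Invariance of Lebesgue measure under reflections *)

Section Reflection.
Context {R : realType}.
Local Notation mu := (@lebesgue_measure R).

Let reflect (t : R) : measurableTypeR R -> measurableTypeR R := fun s => t - s.

Let measurable_reflect t : measurable_fun [set: measurableTypeR R] (reflect t).
Proof. by apply: measurable_funB => //; exact: measurable_cst. Qed.

Lemma reflect_itv (t a b : R) :
  (fun s : R => t - s) @^-1` `]a, b] = `[t - b, t - a[%classic.
Proof.
apply/seteqP; split => s /=; rewrite !in_itv /= => /andP[h1 h2];
  apply/andP; split; lra.
Qed.

Lemma lebesgue_measure_reflect (t : R) (A : set R) : measurable A ->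
  pushforward mu (reflect t) A = mu A.
Proof.
move=> mA; apply/esym/lebesgue_measure_unique => //= _ [[a b]] _ <-.
rewrite /pushforward /= /reflect reflect_itv !lebesgue_measure_itv/=.
rewrite !lte_fin ltrD2l ltrN2; case: ifP => // ab.
by rewrite -!EFinD; congr EFin; lra.
Qed.

(** No integrability is assumed: the positive and negative parts are reflected
    separately, so both sides agree even when the integrals diverge. *)
Lemma integral_reflect (t : R) (f : R -> \bar R) : measurable_fun setT f ->
  (\int[mu]_s f (t - s)%R = \int[mu]_s f s)%E.
Proof.
move=> mf.
have ge0 g : measurable_fun setT g -> (forall s : R, 0 <= g s)%E ->
    (\int[mu]_s g (t - s)%R = \int[mu]_s g s)%E.
  move=> mg g0.
  transitivity (\int[pushforward mu (reflect t)]_s g s)%E; last first.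
    by apply: eq_measure_integral => //= A mA _; exact: lebesgue_measure_reflect.
  by rewrite ge0_integral_pushforward//= preimage_setT.
rewrite [LHS]integralE [RHS]integralE.
congr (_ - _)%E.
  rewrite -(ge0 f^\+%E); [|exact: measurable_funepos|by []].
  by apply: eq_integral => s _; rewrite !funeposE.
rewrite -(ge0 f^\-%E); [|exact: measurable_funeneg|by []].
by apply: eq_integral => s _; rewrite !funenegE.
Qed.

Lemma integral_translate (t : R) (f : R -> \bar R) : measurable_fun setT f ->
  (\int[mu]_s f (s - t)%R = \int[mu]_s f s)%E.
Proof.
move=> mf; rewrite -(integral_reflect 0 mf) -(integral_reflect t); last first.
  apply: measurableT_comp => //.
  by apply: measurable_funB => //; exact: measurable_cst.
by apply: eq_integral => s _; congr f; lra.
Qed.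

Lemma ae_reflect (t : R) (P : R -> Prop) :
  (\forall s \ae mu, P s) -> \forall s \ae mu, P (t - s).
Proof.
move=> [N [mN N0 PN]]; exists ((reflect t) @^-1` N); split.
- by rewrite -[X in measurable X]setTI; exact: measurable_reflect.
- by rewrite -[LHS]/(pushforward mu (reflect t) N) lebesgue_measure_reflect.
- by move=> s /= nP; apply: PN.
Qed.

End Reflection.


(** * The Fejer kernel *)

Section Fejer.
Context {R : realType}.
Local Notation mu := (@lebesgue_measure R).

Lemma integral_is_derive (F f : R -> R) (a b : R) : a < b -> continuous f ->
  (forall x : R, is_derive x 1 F (f x)) ->
  (\int[mu]_(x in `[a, b]) (f x)%:E = (F b - F a)%:E)%E.
Proof.
move=> ab cf dF.
have cF : continuous F.
  by move=> x; apply/differentiable_continuous/derivable1_diffP.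
rewrite (@continuous_FTC2 _ f F a b)//.
- exact: continuous_subspaceT.
- split=> [x _||]; first exact: ex_derive.
  + by apply: cvg_at_right_filter; exact: cF.
  + by apply: cvg_at_left_filter; exact: cF.
- by move=> x _; rewrite derive1E derive_val.
Qed.

(** Both bounds come from the mean value theorem: [sin x = x * cos y] for some
    [y] between 0 and [x], and [cos] decreases there. *)
Lemma sin_bounds_pihalf (x : R) : 0 < x <= pi / 2 ->
  sin x <= x /\ x * cos x <= sin x.
Proof.
move=> /andP[x0 xpi].
have dsin (y : R) : y \in `]0, x[%R -> is_derive y 1 sin (cos y).
  by move=> _; exact: is_derive_sin.
have csin : {within `[0, x], continuous (@sin R)}.
  exact/continuous_subspaceT/continuous_sin.
have [y + E] := MVT x0 dsin csin.
rewrite in_itv /= => /andP[y0 yx]; move: E; rewrite sin0 !subr0 => ->.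
have ? := pi_gt0 R.
split; first by rewrite ger_pMl// cos_le1.
rewrite mulrC ler_pM2r// leNgt ltr_cos ?in_itv/=.
- by rewrite -leNgt ltW.
- by apply/andP; split; lra.
- by apply/andP; split; lra.
Qed.

(** The two kernels are given as cosine sums, rather than as quotients of sines,
    so that they are continuous at 0 and have an explicit primitive. *)
Definition dirichlet (n : nat) (x : R) : R :=
  1 + \sum_(k < n) 2 * cos (2 * k.+1%:R * x).

Definition fejer (n : nat) (x : R) : R := \sum_(m < n) dirichlet m x.

Lemma dirichlet_sin n x : dirichlet n x * sin x = sin ((2 * n%:R + 1) * x).
Proof.
elim: n => [|n IH]; first by rewrite /dirichlet big_ord0 addr0 mulr0 add0r !mul1r.
have -> : dirichlet n.+1 x = dirichlet n x + 2 * cos (2 * n.+1%:R * x).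
  by rewrite /dirichlet big_ord_recr /= addrA.
rewrite mulrDl IH.
have -> : (2 * n%:R + 1) * x = 2 * n.+1%:R * x - x by rewrite -natr1; ring.
have -> : (2 * n.+1%:R + 1) * x = 2 * n.+1%:R * x + x by ring.
by rewrite sinB sinD; ring.
Qed.

Lemma fejer_sin2 n x : fejer n x * sin x ^+ 2 = sin (n%:R * x) ^+ 2.
Proof.
elim: n => [|n IH]; first by rewrite /fejer big_ord0 !mul0r sin0 expr0n.
have -> : fejer n.+1 x = fejer n x + dirichlet n x.
  by rewrite /fejer big_ord_recr.
rewrite mulrDl IH expr2 mulrA dirichlet_sin.
have -> : (2 * n%:R + 1) * x = n.+1%:R * x + n%:R * x by rewrite -natr1; ring.
have E : n.+1%:R * x = n%:R * x + x by rewrite -natr1; ring.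
have -> : sin x = sin (n.+1%:R * x - n%:R * x) by congr sin; rewrite E; ring.
rewrite sinD sinB.
have := cos2Dsin2 (n%:R * x); have := cos2Dsin2 (n.+1%:R * x).
move: (cos (n.+1%:R * x)) (cos (n%:R * x)) (sin (n.+1%:R * x)) (sin (n%:R * x)).
move=> c1 c s1 s h1 h.
have -> : s ^+ 2 + (s1 * c + c1 * s) * (s1 * c - c1 * s)
    = s ^+ 2 * (1 - c1 ^+ 2) + s1 ^+ 2 * c ^+ 2 by ring.
have -> : 1 - c1 ^+ 2 = s1 ^+ 2 by rewrite -h1; ring.
have -> : c ^+ 2 = 1 - s ^+ 2 by rewrite -h; ring.
ring.
Qed.

(** On [[0, pi / 2]] one has [sin x <= x] and [x cos x <= sin x], that is
    [cos^2 x / sin^2 x <= 1 / x^2 <= 1 / sin^2 x]; the outer terms differ by 1,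
    and the numerator [sin^2 (n x)] is at most 1. *)
Lemma fejer_bounds n (x : R) : 0 < x <= pi / 2 ->
  fejer n x - 1 <= sin (n%:R * x) ^+ 2 / x ^+ 2 <= fejer n x.
Proof.
move=> xpi; have [sx cx] := sin_bounds_pihalf xpi; move/andP: xpi => [x0 xpi].
have s0 : 0 < sin x by apply: sin_gt0_pi; have ? := pi_gt0 R; lra.
have c0 : 0 <= cos x by apply: cos_ge0_pihalf; lra.
have F0 : 0 <= fejer n x.
  by rewrite -(pmulr_lge0 _ (exprn_gt0 2 s0)) fejer_sin2 sqr_ge0.
have S1 : sin (n%:R * x) ^+ 2 <= 1.
  have := cos2Dsin2 (n%:R * x); have := sqr_ge0 (cos (n%:R * x)); lra.
have sx2 : sin x ^+ 2 <= x ^+ 2 by rewrite ler_pXn2r// ?nnegrE; lra.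
have cx2 : (x * cos x) ^+ 2 <= sin x ^+ 2.
  by rewrite ler_pXn2r// ?nnegrE; [apply: mulr_ge0; lra|lra].
have x20 : 0 < x ^+ 2 by exact: exprn_gt0.
have E := fejer_sin2 n x.
have := cos2Dsin2 x => cs.
apply/andP; split.
  rewrite ler_pdivlMr// mulrBl mul1r lerBlDr.
  move: E S1 cx2 cs F0; rewrite exprMn.
  move: (fejer n x) (sin _ ^+ 2) (cos x ^+ 2) (x ^+ 2) (sin x ^+ 2) x20 (exprn_gt0 2 s0)
    => F S C X s X0 s20 E S1 cx2 cs F0.
  have -> : F * X = F * s + F * (X * C - s + X * s) by rewrite -[LHS]mulr1 -cs; ring.
  rewrite E lerD2l.
  apply: (@le_trans _ _ (F * (X * s))); first by rewrite ler_wpM2l//; lra.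
  have -> : F * (X * s) = S * X by rewrite -E; ring.
  by rewrite ler_piMl// ltW.
rewrite ler_pdivrMr// -E.
exact: ler_wpM2l.
Qed.

Definition fejer_primitive (n : nat) (x : R) : R :=
  \sum_(m < n) (x + \sum_(k < m) sin (2 * k.+1%:R * x) / k.+1%:R).

Lemma is_derive_fejer_primitive n (x : R) :
  is_derive x 1 (fejer_primitive n) (fejer n x).
Proof.
rewrite (_ : fejer_primitive n = \sum_(m < n)
   (id + \sum_(k < m) (fun x => sin (2 * k.+1%:R * x) / k.+1%:R))); last first.
  apply/funext => y; rewrite fct_sumE; apply: eq_bigr => m _ /=.
  by rewrite fctE fct_sumE.
apply: is_derive_sum => m; apply: is_deriveD.
apply: is_derive_sum => k.
have k0 : k.+1%:R != 0 :> R by rewrite pnatr_eq0.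
have dm : is_derive x 1 ((2 * k.+1%:R) \*: @id R) (2 * k.+1%:R).
  by apply: is_derive_eq; rewrite /GRing.scale/= mulr1.
have ds := @is_derive1_comp _ sin ((2 * k.+1%:R) \*: @id R) x _ _
  (is_derive_sin _) dm.
have := @is_deriveZ _ _ _ _ (k.+1%:R^-1) x 1 _ ds.
rewrite (_ : _ *: _ = 2 * cos (2 * k.+1%:R * x)); last first.
  by rewrite /GRing.scale/=; move: k.+1%:R k0 => y y0; field.
move=> dk; rewrite [X in is_derive _ _ X](_ : _ =
  k.+1%:R^-1 \*: (sin \o (2 * k.+1%:R \*: @id R)))//.
by apply/funext => y; rewrite /GRing.scale/= mulrC.
Qed.

Lemma continuous_fejer n : continuous (fejer n).
Proof.
move=> x; apply: cvg_big => [|m _]; first exact: add_continuous.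
apply: cvgD; first exact: cvg_cst.
apply: cvg_big => [|k _]; first exact: add_continuous.
apply: cvgMl_tmp; apply: continuous_cvg; first exact: continuous_cos.
by apply: cvgMl_tmp; exact: cvg_id.
Qed.

Lemma fejer_primitive0 n : fejer_primitive n 0 = 0.
Proof.
by rewrite /fejer_primitive big1// => m _; rewrite big1 ?addr0// => k _; rewrite mulr0 sin0 mul0r.
Qed.

Lemma sin_natr_pi k : sin (k%:R * pi) = 0 :> R.
Proof.
elim: k => [|k IH]; first by rewrite mul0r sin0.
by rewrite -natr1 mulrDl mul1r sinDpi IH oppr0.
Qed.

(** At [pi / 2] every sine of the primitive is taken at a multiple of [pi]. *)
Lemma fejer_primitive_pihalf n : fejer_primitive n (pi / 2) = n%:R * (pi / 2).
Proof.
rewrite /fejer_primitive (eq_bigr (fun=> pi / 2)) ?sumr_const ?card_ord ?mulr_natl// => m _.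
rewrite big1 ?addr0// => k _.
have -> : 2 * k.+1%:R * (pi / 2) = k.+1%:R * pi :> R by field.
by rewrite sin_natr_pi mul0r.
Qed.

End Fejer.


(** * The integral of the squared cardinal sine *)

Section SincSquare.
Context {R : realType}.
Local Notation mu := (@lebesgue_measure R).

(** The constant [k] makes the lemma cover both sides of [fejer_bounds]. *)
Lemma integral_fejer (n : nat) (c k : R) : 0 < c ->
  (\int[mu]_(s in `[0%R, (pi / 2 / c)%R]) (c ^+ 2 * fejer n (c * s) - k)%:E
   = (c * (n%:R * (pi / 2)) - k * (pi / 2 / c))%:E)%E.
Proof.
move=> c0; have p0 := pi_gt0 R.
have dc (s : R) : is_derive s 1 (c \*: @id R) c.
  by apply: is_derive_eq; rewrite /GRing.scale/= mulr1.
have dG (s : R) : is_derive s 1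
    (c \*: (fejer_primitive n \o (c \*: @id R)) - k \*: @id R)
    (c ^+ 2 * fejer n (c * s) - k).
  have dF := @is_derive1_comp _ (fejer_primitive n) (c \*: @id R) s _ _
    (is_derive_fejer_primitive _ _) (dc s).
  by apply: is_derive_eq; rewrite /GRing.scale/=; ring.
rewrite (integral_is_derive _ _ dG).
- congr EFin; rewrite !fctE /= !scaler0 fejer_primitive0 scaler0 !subr0 /GRing.scale/=.
  by rewrite [c * (pi / 2 / c)]mulrC divfK ?gt_eqF// fejer_primitive_pihalf.
- by rewrite !divr_gt0.
- move=> s; apply: cvgB; last exact: cvg_cst.
  apply: cvgMl_tmp; apply: continuous_cvg; first exact: continuous_fejer.
  by apply: cvgMl_tmp; exact: cvg_id.
Qed.

(** With [N = n + 1], the change of variables [x = c s / N] maps the interval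
    [[0, N * (pi / 2 / c)]] onto [[0, pi / 2]], where [fejer_bounds] applies; the
    error term of size 1 contributes only [c * (pi / 2) / N]. *)
Lemma integral_sinc2_bounds (q : R -> R) (c : R) (n : nat) : 0 < c ->
  continuous q -> (forall s, q s * s ^+ 2 = sin (c * s) ^+ 2) ->
  ((c * (pi / 2) - c * (pi / 2) / n.+1%:R)%:E <=
   \int[mu]_(s in `[0%R, (n.+1%:R * (pi / 2 / c))%R]) (q s)%:E <= (c * (pi / 2))%:E)%E.
Proof.
move=> c0 cq qE; have p0 : 0 < pi :> R := pi_gt0 R.
set N := n.+1%:R : R; have N0 : 0 < N by rewrite ltr0n.
have d0 : 0 < c / N by rewrite divr_gt0.
have TE : N * (pi / 2 / c) = pi / 2 / (c / N) by field; lra.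
have integ (k : R) : mu.-integrable `[0, N * (pi / 2 / c)]
    (fun s => ((c / N) ^+ 2 * fejer n.+1 (c / N * s) - k)%:E).
  apply: continuous_compact_integrable; first exact: segment_compact.
  apply: continuous_subspaceT => s; apply: cvgB; last exact: cvg_cst.
  apply: cvgMl_tmp; apply: continuous_cvg; first exact: continuous_fejer.
  by apply: cvgMl_tmp; exact: cvg_id.
have intq : mu.-integrable `[0, N * (pi / 2 / c)] (EFin \o q).
  apply: continuous_compact_integrable; first exact: segment_compact.
  exact: continuous_subspaceT.
have bounds s : `]0, N * (pi / 2 / c)]%classic s ->
    (c / N) ^+ 2 * fejer n.+1 (c / N * s) - (c / N) ^+ 2 <= q s <=
    (c / N) ^+ 2 * fejer n.+1 (c / N * s) - 0.
  rewrite /= in_itv /= => /andP[s0 sT].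
  have xpi : 0 < c / N * s <= pi / 2.
    rewrite mulr_gt0//=; move: sT; rewrite TE ler_pdivlMr// mulrC//.
  have := fejer_bounds n.+1 xpi; rewrite -/N.
  have -> : N * (c / N * s) = c * s by field; lra.
  have -> : sin (c * s) ^+ 2 / (c / N * s) ^+ 2 = q s / (c / N) ^+ 2.
    rewrite -qE exprMn; field.
    by rewrite ?mulf_neq0 ?expf_neq0 ?gt_eqF.
  move=> /andP[h1 h2]; rewrite ler_pdivrMr ?exprn_gt0// in h2.
  rewrite ler_pdivlMr ?exprn_gt0// in h1.
  move: h1 h2; move: (fejer _ _) ((c / N) ^+ 2) (q s) => f d y h1 h2.
  by apply/andP; split; lra.
have mono (f g : R -> R) : mu.-integrable `[0, N * (pi / 2 / c)] (EFin \o f) ->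
    mu.-integrable `[0, N * (pi / 2 / c)] (EFin \o g) ->
    (forall s, `]0, N * (pi / 2 / c)]%classic s -> f s <= g s) ->
    (\int[mu]_(s in `[0%R, (N * (pi / 2 / c))%R]) (f s)%:E <=
     \int[mu]_(s in `[0%R, (N * (pi / 2 / c))%R]) (g s)%:E)%E.
  (* The pointwise bounds hold away from 0 only. *)
  have sub (e : R -> \bar R) : mu.-integrable `[0, N * (pi / 2 / c)] e ->
      mu.-integrable `]0, N * (pi / 2 / c)] e.
    by apply: integrableS => //; exact: subset_itv_oc_cc.
  move=> fi gi fg; have [{}fi {}gi] := (sub _ fi, sub _ gi).
  rewrite -(integral_itv_obnd_cbnd (measurable_int _ fi)).
  rewrite -(integral_itv_obnd_cbnd (measurable_int _ gi)).
  by apply: le_integral => // s /set_mem/fg; rewrite lee_fin.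
apply/andP; split.
  rewrite [leLHS](_ : _ = (c / N * (N * (pi / 2)) - (c / N) ^+ 2 * (pi / 2 / (c / N)))%:E).
    rewrite -integral_fejer// -TE; apply: mono; [exact: integ|exact: intq|by move=> s /bounds/andP[]].
  by congr EFin; field; rewrite !gt_eqF.
rewrite [leRHS](_ : _ = (c / N * (N * (pi / 2)) - 0 * (pi / 2 / (c / N)))%:E).
  rewrite -integral_fejer// -TE; apply: mono; [exact: intq|exact: integ|by move=> s /bounds/andP[]].
by congr EFin; field; rewrite !gt_eqF.
Qed.

(** The integrand is characterized by [q s * s ^+ 2] instead of a quotient, so
    that its value at 0 is the one continuity forces. *)
Lemma integral_sinc2 (q : R -> R) (c : R) : 0 < c -> continuous q ->
  (forall s, 0 <= q s) -> (forall s, q s * s ^+ 2 = sin (c * s) ^+ 2) ->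
  (\int[mu]_(s in `[0%R, +oo[) (q s)%:E = (c * (pi / 2))%:E)%E.
Proof.
move=> c0 cq q0 qE; have p0 := pi_gt0 R.
pose T := pi / 2 / c; have T0 : 0 < T by rewrite !divr_gt0.
pose F (n : nat) := `[0, n.+1%:R * T]%classic.
have UF : \bigcup_n F n = `[0, +oo[%classic.
  apply/seteqP; split => [s [n _]|s]; rewrite /F /= !in_itv /= andbT.
    by case/andP.
  move=> s0; have [n sn] : exists n, s / T < n%:R.
    by exists (Num.bound (s / T)); apply: archi_boundP; rewrite divr_ge0// ltW.
  exists n => //=; rewrite in_itv/= s0/= -ler_pdivrMr//.
  by rewrite (le_trans (ltW sn))// ler_nat.
have cvgF : ((\int[mu]_(s in F n) (q s)%:E)%E @[n --> \oo] -->
    (\int[mu]_(s in `[0%R, +oo[) (q s)%:E)%E).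
  rewrite -UF; apply: ge0_nondecreasing_set_cvg_integral => //.
  - apply/nondecreasing_seqP => n; rewrite subsetEset => s.
    rewrite /F /= !in_itv /= => /andP[-> /=] /le_trans; apply.
    by rewrite ler_pM2r// ler_nat.
  - by move=> n; exact: measurable_itv.
  - by move=> n; apply: measurable_funTS; apply/measurable_EFinP; exact: continuous_measurable_fun.
  - by move=> n s _; rewrite lee_fin.
apply: (cvg_unique _ cvgF) => //.
apply: (@squeeze_cvge _ _ _ _ (fun n => (c * (pi / 2) - c * (pi / 2) / n.+1%:R)%:E) _
  (fun=> (c * (pi / 2))%:E)).
- by apply: nearW => n; exact: integral_sinc2_bounds.
- apply/cvg_EFin; first by apply: nearW.
  rewrite -[X in _ --> X]subr0; apply: cvgB; first exact: cvg_cst.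
  rewrite -(mulr0 (c * (pi / 2))); apply: cvgMl_tmp; exact: cvg_harmonic.
- exact: cvg_cst.
Qed.

End SincSquare.


(** * Square integrable complex signals *)

Section ComplexSignals.
Context {R : realType}.
Local Notation mu := (@lebesgue_measure R).
Local Notation nc := (@Normc.normc R).
Local Notation Re := (@complex.Re R).
Local Notation Im := (@complex.Im R).
Implicit Types (x y h : @signal R) (z w : R[i]).

Lemma normc_ge0 z : 0 <= nc z.
Proof. by case: z => a b; exact: sqrtr_ge0. Qed.

Lemma sqr_normc z : nc z ^+ 2 = Re z ^+ 2 + Im z ^+ 2.
Proof. by case: z => a b /=; rewrite sqr_sqrtr// addr_ge0 ?sqr_ge0. Qed.

Lemma Re_mul z w : Re (z * w) = Re z * Re w - Im z * Im w.
Proof. by case: z w => a b [c d]. Qed.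

Lemma Im_mul z w : Im (z * w) = Re z * Im w + Im z * Re w.
Proof. by case: z w => a b [c d]. Qed.

Lemma Re_add z w : Re (z + w) = Re z + Re w.
Proof. by case: z w => a b [c d]. Qed.

Lemma Im_add z w : Im (z + w) = Im z + Im w.
Proof. by case: z w => a b [c d]. Qed.

(** Cauchy-Schwarz in the plane. *)
Lemma dot_le_normc (a b : R) z : a * Re z + b * Im z <= Num.sqrt (a ^+ 2 + b ^+ 2) * nc z.
Proof.
have -> : a * Re z + b * Im z = Re ((a -i* b) * z) by rewrite Re_mul /=; ring.
have -> : Num.sqrt (a ^+ 2 + b ^+ 2) = nc (a -i* b) by rewrite /= sqrrN.
rewrite -Normc.normcM; case: (_ * z) => c d /=.
by rewrite (le_trans (ler_norm _))// -sqrtr_sqr ler_wsqrtr// lerDl sqr_ge0.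
Qed.

Lemma normr_Re_le z : `|Re z| <= nc z.
Proof. by case: z => a b /=; rewrite -sqrtr_sqr ler_wsqrtr// lerDl sqr_ge0. Qed.

Lemma normr_Im_le z : `|Im z| <= nc z.
Proof. by case: z => a b /=; rewrite -sqrtr_sqr ler_wsqrtr// lerDr sqr_ge0. Qed.

Lemma measurable_normc x : cmeasurable x -> measurable_fun setT (nc \o x).
Proof.
move=> [mr mi]; have -> : nc \o x = Num.sqrt \o
    (fun t => Re (x t) ^+ 2 + Im (x t) ^+ 2).
  by apply/funext => t /=; case: (x t).
apply: measurableT_comp; first by apply: continuous_measurable_fun; exact: sqrt_continuous.
by apply: measurable_funD; exact: measurable_funX.
Qed.

Lemma cmeasurableM x y : cmeasurable x -> cmeasurable y ->
  cmeasurable (fun t => x t * y t).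
Proof.
move=> [xr xi] [yr yi]; split.
  rewrite (_ : (fun t => _) = (fun t => Re (x t) * Re (y t) - Im (x t) * Im (y t))).
    by apply: measurable_funB; exact: measurable_funM.
  by apply/funext => t; rewrite Re_mul.
rewrite (_ : (fun t => _) = (fun t => Re (x t) * Im (y t) + Im (x t) * Re (y t))).
  by apply: measurable_funD; exact: measurable_funM.
by apply/funext => t; rewrite Im_mul.
Qed.

Lemma cmeasurable_comp x (f : R -> R) : cmeasurable x ->
  measurable_fun [set: R] f -> cmeasurable (x \o f).
Proof.
by move=> [xr xi] mf; split; [exact: (measurableT_comp xr)|exact: (measurableT_comp xi)].
Qed.

Lemma Lp_norm2E x :
  Lp_norm 2%:E x = sqrte (\int[mu]_t (nc (x t) ^+ 2)%:E)%E.
Proof.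
rewrite /Lp_norm unlock -poweR12_sqrt; last first.
  by apply: integral_ge0 => t _; rewrite lee_fin sqr_ge0.
congr (_ `^ _)%E; apply: eq_integral => t _.
by rewrite poweR_EFin powR_mulrn// ger0_norm// normc_ge0.
Qed.

Let sqr_normc_ge0 x : (0 <= \int[mu]_t (nc (x t) ^+ 2)%:E)%E.
Proof. by apply: integral_ge0 => t _; rewrite lee_fin sqr_ge0. Qed.

Lemma measurable_sqr_normc x : cmeasurable x ->
  measurable_fun setT (fun t => (nc (x t) ^+ 2)%:E).
Proof.
by move=> mx; apply/measurable_EFinP; apply: measurable_funX; exact: measurable_normc.
Qed.

Lemma L2P x : Lp 2%:E x <->
  cmeasurable x /\ mu.-integrable setT (fun t => (nc (x t) ^+ 2)%:E).
Proof.
rewrite /Lp/= Lp_norm2E -ge0_fin_numE ?sqrte_ge0// sqrte_fin_num// ge0_fin_numE//.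
split=> -[mx Ix]; split=> //.
  apply/integrableP; split; first exact: measurable_sqr_normc.
  by under eq_integral do rewrite gee0_abs ?lee_fin ?sqr_ge0//.
move/integrableP : Ix => [_]; apply: le_lt_trans.
rewrite le_eqVlt; apply/orP; left; apply/eqP.
by apply: eq_integral => t _; rewrite gee0_abs ?lee_fin ?sqr_ge0.
Qed.

Lemma Lp_norm2_fin_num x : Lp 2%:E x -> Lp_norm 2%:E x \is a fin_num.
Proof. by move=> [_]; rewrite ge0_fin_numE// Lp_norm2E sqrte_ge0. Qed.

Lemma integral_reflect_sqr t h : cmeasurable h ->
  (\int[mu]_s (nc (h (t - s)%R) ^+ 2)%:E = \int[mu]_s (nc (h s) ^+ 2)%:E)%E.
Proof.
move=> mh; rewrite (integral_reflect t (f := fun s => (nc (h s) ^+ 2)%:E))//.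
exact: measurable_sqr_normc.
Qed.

Let measurable_reflect (t : R) : measurable_fun [set: R] (fun s => t - s).
Proof. by apply: measurable_funB => //; exact: measurable_cst. Qed.

Lemma Lp_norm2_reflect t h : cmeasurable h ->
  Lp_norm 2%:E (fun s => h (t - s)) = Lp_norm 2%:E h.
Proof. by move=> mh; rewrite !Lp_norm2E integral_reflect_sqr. Qed.

Lemma L2_reflect t h : Lp 2%:E h -> Lp 2%:E (fun s => h (t - s)).
Proof.
move=> [mh nh]; split; last by rewrite Lp_norm2_reflect.
exact: cmeasurable_comp (measurable_reflect t).
Qed.

Lemma integrable_normcM x y : Lp 2%:E x -> Lp 2%:E y ->
  mu.-integrable setT (fun t => (nc (x t * y t))%:E).
Proof.
move=> /L2P[mx Ix] /L2P[my Iy].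
apply: le_integrable (integrableD _ Ix Iy) => //.
  by apply/measurable_EFinP; apply: measurable_normc; exact: cmeasurableM.
move=> t _; rewrite Normc.normcM -EFinD !gee0_abs ?lee_fin
  ?addr_ge0 ?sqr_ge0 ?mulr_ge0 ?normc_ge0//.
have := sqr_ge0 (nc (x t) - nc (y t)); have := sqr_ge0 (nc (x t) + nc (y t)).
rewrite sqrrB sqrrD; lra.
Qed.

Lemma integrable_Re x : cmeasurable x ->
  mu.-integrable setT (fun t => (nc (x t))%:E) ->
  mu.-integrable setT (fun t => (Re (x t))%:E).
Proof.
move=> [mr mi]; apply: le_integrable => //; first exact/measurable_EFinP.
by move=> t _ /=; rewrite lee_fin (ger0_norm (normc_ge0 _)) normr_Re_le.
Qed.

Lemma integrable_Im x : cmeasurable x ->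
  mu.-integrable setT (fun t => (nc (x t))%:E) ->
  mu.-integrable setT (fun t => (Im (x t))%:E).
Proof.
move=> [mr mi]; apply: le_integrable => //; first exact/measurable_EFinP.
by move=> t _ /=; rewrite lee_fin (ger0_norm (normc_ge0 _)) normr_Im_le.
Qed.

(** With [a + ib] the value of the integral and [r] its modulus,
    [r ^+ 2 = \int (a * Re x + b * Im x)], and the integrand is at most
    [r * |x|]. *)
Lemma normc_cintegral_le x : cmeasurable x ->
  mu.-integrable setT (fun t => (nc (x t))%:E) ->
  nc (cintegral setT x) <= \int[mu]_t nc (x t).
Proof.
move=> mx Ix; have [Ir Ii] := (integrable_Re mx Ix, integrable_Im mx Ix).
have I0 : 0 <= \int[mu]_t nc (x t) by apply: Rintegral_ge0 => t _; exact: normc_ge0.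
rewrite /cintegral; set a := (\int[mu]_(t in _) Re _); set b := (\int[mu]_(t in _) Im _).
rewrite /=; set r := Num.sqrt _.
have [->|r0] := eqVneq r 0; first by [].
have {}r0 : 0 < r by rewrite lt_neqAle eq_sym r0 sqrtr_ge0.
rewrite -(ler_pM2l r0) -expr2 sqr_sqrtr ?addr_ge0 ?sqr_ge0//.
rewrite -RintegralZl//.
rewrite expr2 {2}/a expr2 {2}/b -!RintegralZl//.
have IZ (k : R) (f : R -> R) : mu.-integrable setT (EFin \o f) ->
    mu.-integrable setT (EFin \o (fun t => k * f t)).
  exact: integrableZl.
rewrite -RintegralD//; [|exact: IZ|exact: IZ].
apply: le_Rintegral => //.
- by have := integrableD measurableT (IZ a _ Ir) (IZ b _ Ii); apply: eq_integrable.
- exact: IZ.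
- by move=> t _; exact: dot_le_normc.
Qed.

Lemma cauchy_schwarz x y : Lp 2%:E x -> Lp 2%:E y ->
  ((nc (cintegral setT (fun t => x t * y t)))%:E
    <= Lp_norm 2%:E x * Lp_norm 2%:E y)%E.
Proof.
move=> Lx Ly; have Ixy := integrable_normcM Lx Ly.
have [[mx _] [my _]] := (Lx, Ly).
apply: (@le_trans _ _ (\int[mu]_t nc (x t * y t))%:E).
  by rewrite lee_fin normc_cintegral_le//; exact: cmeasurableM.
have half : 2^-1 + 2^-1 = 1 :> R by rewrite -div1r -splitr.
apply: le_trans (hoelder mu (measurable_normc mx) (measurable_normc my)
  (ltr0Sn _ _) (ltr0Sn _ _) half).
rewrite Lnorm1 /Rintegral fineK ?integrable_fin_num//.
rewrite le_eqVlt; apply/orP; left; apply/eqP; apply: eq_integral => t _ /=.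
by rewrite Normc.normcM ger0_norm// mulr_ge0 ?normc_ge0.
Qed.

End ComplexSignals.

Section Restriction.
Context {R : realType}.
Local Notation mu := (@lebesgue_measure R).
Local Notation nc := (@Normc.normc R).
Implicit Types h : @signal R.

Definition restrict_signal (A : set R) h : @signal R :=
  fun t => if t \in A then h t else 0.

Lemma integral_sqr_restrict h (A : set R) :
  (\int[mu]_t (nc (restrict_signal A h t) ^+ 2)%:E = \int[mu]_(t in A) (nc (h t) ^+ 2)%:E)%E.
Proof.
rewrite [RHS]integral_mkcond; apply: eq_integral => t _; rewrite /restrict_signal patchE.
by case: ifP => // _; rewrite Normc.normc0 expr0n.
Qed.

Lemma cmeasurable_restrict h (A : set R) : measurable A -> cmeasurable h ->
  cmeasurable (restrict_signal A h).
Proof.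
move=> mA [hr hi]; split.
  rewrite (_ : (fun _ => _) = (fun t => complex.Re (h t)) \_ A).
    by apply/(measurable_restrictT _ mA)/measurable_funTS.
  by apply/funext => t; rewrite /restrict_signal patchE; case: ifP.
rewrite (_ : (fun _ => _) = (fun t => complex.Im (h t)) \_ A).
  by apply/(measurable_restrictT _ mA)/measurable_funTS.
by apply/funext => t; rewrite /restrict_signal patchE; case: ifP.
Qed.

Lemma L2_restrict h (A : set R) : measurable A -> Lp 2%:E h -> Lp 2%:E (restrict_signal A h).
Proof.
move=> mA [mh nh]; split; first exact: cmeasurable_restrict.
move: nh; rewrite !Lp_norm2E integral_sqr_restrict; apply: le_lt_trans.
rewrite lee_sqrt; last by apply: integral_ge0 => t _; rewrite lee_fin sqr_ge0.
apply: ge0_subset_integral => //; first exact: measurable_sqr_normc.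
by move=> t _; rewrite lee_fin sqr_ge0.
Qed.

End Restriction.


(** * Convolution filters *)

Section Convolution.
Context {R : realType}.
Local Notation mu := (@lebesgue_measure R).
Local Notation nc := (@Normc.normc R).
Local Notation Re := (@complex.Re R).
Local Notation Im := (@complex.Im R).
(* Unqualified, [conv] is the convex combination operator. *)
Local Notation conv := (@Defs.conv R).
Implicit Types (x y h g : @signal R) (z w c : R[i]).

Definition cintegrable x :=
  cmeasurable x /\ mu.-integrable setT (fun t => (nc (x t))%:E).

Lemma cintegral_linear c x y : cintegrable x -> cintegrable y ->
  cintegral setT (fun t => c * x t + y t) = c * cintegral setT x + cintegral setT y.
Proof.
move=> [mx Ix] [my Iy].
have [xr xi] := (integrable_Re mx Ix, integrable_Im mx Ix).
have [yr yi] := (integrable_Re my Iy, integrable_Im my Iy).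
have IZ (k : R) (f : R -> R) : mu.-integrable setT (EFin \o f) ->
    mu.-integrable setT (EFin \o (fun t => k * f t)) by exact: integrableZl.
have ID (f k : R -> R) : mu.-integrable setT (EFin \o f) ->
    mu.-integrable setT (EFin \o k) ->
    mu.-integrable setT (EFin \o (fun t => f t + k t)).
  by move=> If Ik; have := integrableD measurableT If Ik; apply: eq_integrable.
have lin (a b : R) (f k l : R -> R) : mu.-integrable setT (EFin \o f) ->
    mu.-integrable setT (EFin \o k) -> mu.-integrable setT (EFin \o l) ->
    \int[mu]_t (a * f t + b * k t + l t) =
    a * \int[mu]_t f t + b * \int[mu]_t k t + \int[mu]_t l t.
  move=> If Ik Il; rewrite RintegralD//; last by apply: ID; exact: IZ.
  by rewrite RintegralD ?RintegralZl//; exact: IZ.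
case: c => a b; rewrite /cintegral; apply/eqP.
rewrite eq_complex Re_add Im_add Re_mul Im_mul /= -mulNr -!lin//.
by apply/andP; split; apply/eqP; congr Rintegral; apply/funext => t;
  rewrite ?Re_add ?Im_add ?Re_mul ?Im_mul ?mulNr.
Qed.

Lemma Lp_normyE x : Lp_norm +oo%E x = ess_sup mu (fun t => (nc (x t))%:E).
Proof.
have muT : (0 < mu [set: R])%E.
  by rewrite -(@set_itvNyy _ R) lebesgue_measure_itv/= ltry.
rewrite /Lp_norm unlock muT.
congr ess_sup.
by apply/funext => t /=; rewrite ger0_norm ?normc_ge0.
Qed.

Lemma integrable_conv x h t : Lp 2%:E x -> Lp 2%:E h ->
  cintegrable (fun s => x s * h (t - s)).
Proof.
move=> Lx Lh; split; last by apply: integrable_normcM => //; exact: L2_reflect.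
by apply: cmeasurableM; [case: Lx|case: (L2_reflect t Lh)].
Qed.

Lemma conv_linear c x y h t : Lp 2%:E x -> Lp 2%:E y -> Lp 2%:E h ->
  conv (fun u => c * x u + y u) h t = c * conv x h t + conv y h t.
Proof.
move=> Lx Ly Lh; rewrite /conv -cintegral_linear//; try exact: integrable_conv.
by congr cintegral; apply/funext => s; rewrite mulrDl mulrA.
Qed.

Lemma conv_subr x h g t : Lp 2%:E x -> Lp 2%:E h -> Lp 2%:E g ->
  conv x h t - conv x g t = conv x (fun s => h s - g s) t.
Proof.
move=> Lx Lh Lg; rewrite addrC -mulN1r /conv -cintegral_linear//; try exact: integrable_conv.
by congr cintegral; apply/funext => s; rewrite mulN1r mulrBr addrC.
Qed.

Lemma conv_translate s x h t : cmeasurable x -> cmeasurable h ->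
  conv (translate s x) h t = translate s (conv x h) t.
Proof.
move=> mx mh; rewrite /conv /translate.
have [mr mi] : cmeasurable (fun u => x u * h (t - s - u)).
  apply: cmeasurableM => //; apply: cmeasurable_comp => //.
  by apply: measurable_funB => //; exact: measurable_cst.
have E u : t - s - (u - s) = t - u by ring.
rewrite /cintegral /Rintegral; congr (fine _ +i* fine _).
  rewrite -[RHS](integral_translate s)//; last exact/measurable_EFinP.
  by apply: eq_integral => u _; rewrite E.
rewrite -[RHS](integral_translate s)//; last exact/measurable_EFinP.
by apply: eq_integral => u _; rewrite E.
Qed.

Lemma conv_le x h t : Lp 2%:E x -> Lp 2%:E h ->
  ((nc (conv x h t))%:E <= Lp_norm 2%:E x * Lp_norm 2%:E h)%E.
Proof.
move=> Lx Lh; rewrite -(@Lp_norm2_reflect _ t h); last by case: Lh.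
by apply: cauchy_schwarz => //; exact: L2_reflect.
Qed.

Lemma Lp_normy_conv_le x h : Lp 2%:E x -> Lp 2%:E h ->
  (Lp_norm +oo%E (conv x h) <= Lp_norm 2%:E x * Lp_norm 2%:E h)%E.
Proof.
by move=> Lx Lh; rewrite Lp_normyE; apply/ess_supP; apply: nearW => t; exact: conv_le.
Qed.

(** The totalized real integral needs no integrability of the sections: the
    integrals of the positive and negative parts are measurable by Tonelli. *)
Lemma measurable_parametric_integral (k : R * R -> R) :
  measurable_fun setT k ->
  measurable_fun setT (fun t : R => \int[mu]_s k (t, s)).
Proof.
move=> mk; rewrite /Rintegral.
apply: (measurableT_comp (f := fine)); first exact: fine_measurable.
have mek : measurable_fun setT (EFin \o k) by exact/measurable_EFinP.
under eq_fun do rewrite integralE.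
apply: emeasurable_funB.
  rewrite [X in measurable_fun _ X](_ : _ = fubini_F mu ((EFin \o k)^\+)%E).
    apply: measurable_fun_fubini_tonelli_F => //; exact: measurable_funepos.
  by apply/funext => t; apply: eq_integral => s _; rewrite !funeposE.
rewrite [X in measurable_fun _ X](_ : _ = fubini_F mu ((EFin \o k)^\-)%E).
  apply: measurable_fun_fubini_tonelli_F => //; exact: measurable_funeneg.
by apply/funext => t; apply: eq_integral => s _; rewrite !funenegE.
Qed.

Lemma cmeasurable_conv x h : cmeasurable x -> cmeasurable h -> cmeasurable (conv x h).
Proof.
move=> [xr xi] [hr hi].
have mB : measurable_fun [set: R * R] (fun p : R * R => p.1 - p.2).
  by apply: measurable_funB; [exact: measurable_fst|exact: measurable_snd].
have ms := @measurable_snd _ _ R R.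
split.
- apply: (measurable_parametric_integral (k := fun p => Re (x p.2 * h (p.1 - p.2)))).
  under eq_fun do rewrite Re_mul.
  apply: measurable_funB; apply: measurable_funM.
  + exact: (measurableT_comp xr).
  + exact: (measurableT_comp hr).
  + exact: (measurableT_comp xi).
  + exact: (measurableT_comp hi).
- apply: (measurable_parametric_integral (k := fun p => Im (x p.2 * h (p.1 - p.2)))).
  under eq_fun do rewrite Im_mul.
  apply: measurable_funD; apply: measurable_funM.
  + exact: (measurableT_comp xr).
  + exact: (measurableT_comp hi).
  + exact: (measurableT_comp xi).
  + exact: (measurableT_comp hr).
Qed.

Lemma analog_conv_filter h : Lp 2%:E h -> analog_filter (conv_filter h).
Proof.
move=> Lh; have [mh _] := Lh; split.
- move=> x Lx; have [mx _] := Lx; split; first exact: cmeasurable_conv.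
  apply: le_lt_trans (Lp_normy_conv_le Lx Lh) _.
  by rewrite ltey_eq fin_numM ?Lp_norm2_fin_num.
- by move=> c x y Lx Ly; apply: nearW => t; exact: conv_linear.
- exists (fine (Lp_norm 2%:E h)) => x Lx.
  by rewrite fineK ?Lp_norm2_fin_num// muleC; exact: Lp_normy_conv_le.
- by move=> s x [mx _]; apply: nearW => t; exact: conv_translate.
Qed.

Lemma op_norm_le (L : @operator R) h : Lp 2%:E h ->
  (forall x t, Lp 2%:E x -> L x t = conv x h t) -> (op_norm L <= Lp_norm 2%:E h)%E.
Proof.
move=> Lh LE; apply: ge_ereal_sup => _ [x [Lx x1] <-].
rewrite (_ : L x = conv x h); last by apply/funext => t; exact: LE.
apply: le_trans (Lp_normy_conv_le Lx Lh) _.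
rewrite -[leRHS]mul1e; apply: lee_wpmul2r => //.
by rewrite Lp_norm2E sqrte_ge0.
Qed.

End Convolution.


(** * The impulse response of the ideal filter *)

Section IdealResponse.
Context {R : realType}.
Local Notation mu := (@lebesgue_measure R).
Local Notation nc := (@Normc.normc R).
Local Notation Re := (@complex.Re R).
Local Notation Im := (@complex.Im R).

(** Dominated convergence, with the constant 1 on a bounded interval. *)
Lemma continuous_integral_dilation (a b : R) (f : R -> R) : continuous f ->
  (forall u, `|f u| <= 1) ->
  continuous (fun t => \int[mu]_(w in `[a, b]) f (w * t)).
Proof.
move=> cf f1 t.
have cft (s w : R) : {for s, continuous (fun s => f (w * s))}.
  by apply: (@continuous_comp _ _ _ ( *%R w) f); [exact: mulrl_continuous|exact: cf].
have cfw (s : R) : continuous (fun w : R => f (w * s)).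
  by move=> w; apply: cvg_comp; [exact: mulrr_continuous|exact: cf].
apply: (@continuity_under_integral _ _ _ mu (fun t w => f (w * t)) `[a, b]%classic
  _ (t - 1) (t + 1) _ _ (cst 1)) => //.
- move=> s _; apply: continuous_compact_integrable; first exact: segment_compact.
  exact: continuous_subspaceT.
- by apply: nearW => w _ s _; exact: cft.
- apply: continuous_compact_integrable; first exact: segment_compact.
  by apply: continuous_subspaceT; exact: cst_continuous.
- by move=> s _; apply: nearW => w _; exact: f1.
- by rewrite inE /= in_itv/=; apply/andP; split; lra.
Qed.

Lemma integral_cos (a b t : R) : a < b -> t != 0 ->
  \int[mu]_(w in `[a, b]) cos (w * t) = (sin (b * t) - sin (a * t)) / t.
Proof.
move=> ab t0.
have d (w : R) : is_derive w 1 (t^-1 \*: (sin \o (t \*: @id R))) (cos (w * t)).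
  have dt : is_derive w 1 (t \*: @id R) t.
    by apply: is_derive_eq; rewrite /GRing.scale/= mulr1.
  have ds := @is_derive1_comp _ sin (t \*: @id R) w _ _ (is_derive_sin _) dt.
  by apply: is_derive_eq; rewrite /GRing.scale/= mulrC mulfK// mulrC.
rewrite /Rintegral (integral_is_derive ab _ d)/=; last first.
  by move=> w; apply: cvg_comp; [exact: mulrr_continuous|exact: continuous_cos].
by rewrite /GRing.scale/= -mulrBr mulrC ![t * _]mulrC.
Qed.

Lemma integral_sin (a b t : R) : a < b -> t != 0 ->
  \int[mu]_(w in `[a, b]) sin (w * t) = (cos (a * t) - cos (b * t)) / t.
Proof.
move=> ab t0.
have d (w : R) : is_derive w 1 (- t^-1 \*: (cos \o (t \*: @id R))) (sin (w * t)).
  have dt : is_derive w 1 (t \*: @id R) t.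
    by apply: is_derive_eq; rewrite /GRing.scale/= mulr1.
  have ds := @is_derive1_comp _ cos (t \*: @id R) w _ _ (is_derive_cos _) dt.
  apply: is_derive_eq; rewrite /GRing.scale/= [w * t]mulrC; move: (sin _) => s.
  by field.
rewrite /Rintegral (integral_is_derive ab _ d)/=; last first.
  by move=> w; apply: cvg_comp; [exact: mulrr_continuous|exact: continuous_sin].
by rewrite /GRing.scale/= -mulrBr mulrC ![t * _]mulrC; ring.
Qed.

Variables a b : R.
Hypothesis ab : a < b.

Definition ideal_response : @signal R := inv_fourier (fun w => (\1_`[a, b] w)%:C).

Lemma ideal_responseE t : ideal_response t =
  ((Num.sqrt (2 * pi))^-1 * \int[mu]_(w in `[a, b]) cos (w * t)) +i*
  ((Num.sqrt (2 * pi))^-1 * \int[mu]_(w in `[a, b]) sin (w * t)).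
Proof.
rewrite /ideal_response /inv_fourier /cintegral.
have E (f : R -> R) :
    \int[mu]_(w in `[a, b]) f w = \int[mu]_w (\1_`[a, b] w * f w).
  rewrite Rintegral_mkcond; congr Rintegral; apply/funext => w.
  by rewrite patchE indicE; case: ifP => _; rewrite ?mul1r ?mul0r.
rewrite !E.
apply/eqP; rewrite eq_complex Re_mul Im_mul /= !mul0r subr0 addr0.
by apply/andP; split; apply/eqP; congr (_ * _); congr Rintegral; apply/funext => w;
  rewrite ?Re_mul ?Im_mul /= mul0r ?subr0 ?addr0.
Qed.

Lemma continuous_Re_ideal_response : continuous (Re \o ideal_response).
Proof.
rewrite (_ : _ \o _ = (fun t => (Num.sqrt (2 * pi))^-1 *
    \int[mu]_(w in `[a, b]) cos (w * t))).
  move=> t; apply: cvgMl_tmp; apply: continuous_integral_dilation.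
    exact: continuous_cos.
  exact: cos_max.
by apply/funext => t; rewrite [LHS]/comp ideal_responseE.
Qed.

Lemma continuous_Im_ideal_response : continuous (Im \o ideal_response).
Proof.
rewrite (_ : _ \o _ = (fun t => (Num.sqrt (2 * pi))^-1 *
    \int[mu]_(w in `[a, b]) sin (w * t))).
  move=> t; apply: cvgMl_tmp; apply: continuous_integral_dilation.
    exact: continuous_sin.
  exact: sin_max.
by apply/funext => t; rewrite [LHS]/comp ideal_responseE.
Qed.

Lemma cmeasurable_ideal_response : cmeasurable ideal_response.
Proof.
by split; apply: continuous_measurable_fun;
  [exact: continuous_Re_ideal_response|exact: continuous_Im_ideal_response].
Qed.

Let p t := nc (ideal_response t) ^+ 2.

(** Writing [a t = v - u] and [b t = v + u], the real and imaginary parts of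
    [h t] are proportional to [2 cos v sin u / t] and [2 sin v sin u / t]: the
    centre of the frequency band only enters through the phase [v]. *)
Lemma sqr_ideal_response t :
  p t * t ^+ 2 = 2 / pi * sin ((b - a) / 2 * t) ^+ 2.
Proof.
rewrite /p sqr_normc ideal_responseE /=.
have [->|t0] := eqVneq t 0; first by rewrite !mulr0 sin0 expr0n/= !mulr0.
rewrite integral_cos// integral_sin//.
have K : (Num.sqrt (2 * pi))^-1 ^+ 2 = (2 * pi)^-1 :> R.
  by rewrite exprVn sqr_sqrtr// mulr_ge0// pi_ge0.
have -> : b * t = (a + b) / 2 * t + (b - a) / 2 * t by field.
have -> : a * t = (a + b) / 2 * t - (b - a) / 2 * t by field.
have p0 := pi_gt0 R.
move: ((b - a) / 2 * t) ((a + b) / 2 * t) => u v.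
rewrite !exprMn K sinD sinB cosB cosD; have := cos2Dsin2 v.
move: (cos u) (sin u) (cos v) (sin v) => cu su cv sv hv.
transitivity (2 / pi * su ^+ 2 * (cv ^+ 2 + sv ^+ 2)); last by rewrite hv mulr1.
by move: pi p0 => r r0; field; rewrite t0 gt_eqF.
Qed.

Lemma continuous_sqr_ideal_response : continuous p.
Proof.
have -> : p = (fun t => (Re \o ideal_response) t * (Re \o ideal_response) t +
                        (Im \o ideal_response) t * (Im \o ideal_response) t).
  by apply/funext => t; rewrite /p sqr_normc !expr2.
move=> t; apply: cvgD.
  by apply: cvgM; exact: continuous_Re_ideal_response.
by apply: cvgM; exact: continuous_Im_ideal_response.
Qed.

Lemma ideal_response_even t : p (- t) = p t.
Proof.
have [->|t0] := eqVneq t 0; first by rewrite oppr0.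
apply: (@mulIf _ (t ^+ 2)); first by rewrite expf_neq0.
by rewrite -{1}sqrrN !sqr_ideal_response mulrN sinN sqrrN.
Qed.

Lemma integral_sqr_ideal_response_ge0 :
  (\int[mu]_(t in `[0%R, +oo[) (p t)%:E = ((b - a) / 2)%:E)%E.
Proof.
have p0 := pi_gt0 R.
have pos : 0 < pi / 2 :> R by rewrite divr_gt0.
have mp : measurable_fun (`[0%R, +oo[ : set R) (fun t => (p t)%:E).
  apply: measurable_funTS; apply/measurable_EFinP; apply: continuous_measurable_fun.
  exact: continuous_sqr_ideal_response.
have S : (\int[mu]_(t in `[0%R, +oo[) (pi / 2 * p t)%:E =
          ((b - a) / 2 * (pi / 2))%:E)%E.
  apply: integral_sinc2.
  - by rewrite divr_gt0// subr_gt0.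
  - by move=> t; apply: cvgMl_tmp; exact: continuous_sqr_ideal_response.
  - by move=> t; rewrite mulr_ge0 ?sqr_ge0// ltW.
  - move=> t; rewrite -mulrA sqr_ideal_response mulrA.
    by rewrite -[2 / pi]invf_div mulfV ?gt_eqF// mul1r.
move: S; under eq_integral do rewrite EFinM.
rewrite ge0_integralZl_EFin//; last 2 first.
- by move=> t _; rewrite lee_fin sqr_ge0.
- exact: ltW.
move=> /(congr1 (fun x => (pi / 2)^-1%:E * x)%E).
by rewrite muleA -!EFinM mulVf ?gt_eqF// mul1e mulrCA mulVf ?gt_eqF// mulr1.
Qed.

Lemma integral_sqr_ideal_response : (\int[mu]_t (p t)%:E = (b - a)%:E)%E.
Proof.
rewrite ge0_symfun_integralT.
- rewrite -set_itvcy integral_sqr_ideal_response_ge0 -EFinM; congr EFin; lra.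
- by move=> t; rewrite sqr_ge0.
- exact: continuous_sqr_ideal_response.
- by move=> t /=; rewrite ideal_response_even.
Qed.

Lemma integral_sqr_ideal_response_lt0 :
  (\int[mu]_(t in `]-oo, 0%R[) (p t)%:E = ((b - a) / 2)%:E)%E.
Proof.
have mp (D : set R) : measurable_fun D (fun t => (p t)%:E).
  apply: measurable_funTS; apply/measurable_EFinP; apply: continuous_measurable_fun.
  exact: continuous_sqr_ideal_response.
rewrite integral_itv_bndo_bndc//.
have ge0 r : (0 <= (p r)%:E)%E by rewrite lee_fin sqr_ge0.
have := ge0_integration_by_substitution0 (mp setT) ge0.
rewrite integral_sqr_ideal_response_ge0 => ->.
by apply: eq_integral => t _; rewrite ideal_response_even.
Qed.

Lemma L2_ideal_response : Lp 2%:E ideal_response.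
Proof.
split; first exact: cmeasurable_ideal_response.
by rewrite Lp_norm2E integral_sqr_ideal_response ltry.
Qed.

Lemma Lp_norm2_ideal_response :
  Lp_norm 2%:E ideal_response = (Num.sqrt (b - a))%:E.
Proof. by rewrite Lp_norm2E integral_sqr_ideal_response. Qed.

End IdealResponse.


(** * Lower bounds on operator norms by matched inputs *)

Section LowerBound.
Context {R : realType}.
Local Notation mu := (@lebesgue_measure R).
Local Notation nc := (@Normc.normc R).
Local Notation Re := (@complex.Re R).
Local Notation Im := (@complex.Im R).
Local Notation conv := (@Defs.conv R).
Implicit Types (x h : @signal R) (L : @operator R).

Lemma Lp_normy_le_op_norm L x : Lp 2%:E x -> (Lp_norm 2%:E x <= 1)%E ->
  (Lp_norm +oo%E (L x) <= op_norm L)%E.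
Proof. by move=> Lx x1; apply: ereal_sup_ubound; exists x. Qed.

Lemma Lp_norm_ge0 (p : \bar R) x : (0 <= Lp_norm p x)%E.
Proof. exact: Lnorm_ge0. Qed.

Lemma op_norm_ge0 L : (0 <= op_norm L)%E.
Proof.
have n0 : Lp_norm 2%:E (fun=> 0 : R[i]) = 0%E.
  rewrite Lp_norm2E integral0_eq ?sqrte0// => t _.
  by rewrite Normc.normc0 expr0n.
apply: (@le_trans _ _ (Lp_norm +oo%E (L (fun=> 0%R)))); first exact: Lp_norm_ge0.
apply: Lp_normy_le_op_norm; last by rewrite n0 lee01.
split; last by rewrite n0 ltry.
by split; exact: measurable_cst.
Qed.

(** A property that holds almost everywhere on the negative half-line holds at
    points arbitrarily close to 0: an interval has positive measure. *)
Lemma ae_lt0_exists_near0 (P : R -> Prop) : (\forall t \ae mu, t < 0 -> P t) ->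
  forall e : R, 0 < e -> exists2 t : R, - e < t < 0 & P t.
Proof.
move=> [N [mN N0 PN]] e e0; apply/not_exists2P => nP.
have sub : `]- e, 0[ `<=` N.
  move=> t /=; rewrite in_itv/= => te; apply: PN => /= Pt.
  have [//|] := nP t.
  by case/andP: te => _ /Pt Pt' /(_ Pt').
have : (mu `](- e)%R, 0%R[ <= mu N)%E by apply: le_measure; rewrite ?inE.
rewrite N0 lebesgue_measure_itv/= lte_fin oppr_lt0 e0.
by rewrite -EFinD opprK add0r lee_fin leNgt e0.
Qed.

(** The conjugate of [h (- s)], scaled by [r]: the input whose convolution with
    [h] at time 0 is [r] times the energy of [h]. *)
Definition matched_input (r : R) h : @signal R :=
  fun s => (r * Re (h (- s))) +i* (- (r * Im (h (- s)))).

Lemma continuous_reflect (f : R -> R) (u : R) :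
  continuous f -> continuous (fun s => f (u - s)).
Proof.
by move=> cf s; apply: (@continuous_comp _ _ _ (fun s => u - s) f);
  [apply: cvgB; [exact: cvg_cst|exact: cvg_id]|exact: cf].
Qed.

Lemma continuous_opp (f : R -> R) : continuous f -> continuous (fun s => f (- s)).
Proof. by move=> /(@continuous_reflect _ 0); under eq_fun do rewrite sub0r. Qed.

Lemma integrable_correlation h (al be t : R) :
  continuous (Re \o h) -> continuous (Im \o h) ->
  mu.-integrable `[al, be] (EFin \o (fun s =>
    Re (h (- s)) * Re (h (t - s)) + Im (h (- s)) * Im (h (t - s)))).
Proof.
move=> cr ci.
apply: continuous_compact_integrable; first exact: segment_compact.
apply: continuous_subspaceT => s; apply: cvgD; apply: cvgM.
- exact: (continuous_opp cr).
- exact: (@continuous_reflect _ t cr).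
- exact: (continuous_opp ci).
- exact: (@continuous_reflect _ t ci).
Qed.

(** Dominated convergence near [t = 0]: the integrand is bounded by the maximum
    of [|h|^2] over a compact interval containing every [- s] and [t - s] that
    occur when [|t| < 1]. *)
Lemma continuous_correlation h (al be : R) : al <= be ->
  continuous (Re \o h) -> continuous (Im \o h) ->
  {for 0, continuous (fun t => \int[mu]_(s in `[al, be])
    (Re (h (- s)) * Re (h (t - s)) + Im (h (- s)) * Im (h (t - s))))}.
Proof.
move=> albe cr ci.
have cq : continuous (fun t => Re (h t) ^+ 2 + Im (h t) ^+ 2).
  under eq_fun do rewrite !expr2.
  by move=> t; apply: cvgD; apply: cvgM; first [exact: cr|exact: ci].
have [c _ cmax] := @EVT_max R (fun t => Re (h t) ^+ 2 + Im (h t) ^+ 2)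
   (- 1 - be) (1 - al) ltac:(lra) (continuous_subspaceT cq).
pose B := Re (h c) ^+ 2 + Im (h c) ^+ 2.
have shift (f : R -> R) (t s : R) : continuous f -> {for t, continuous (fun t => f (t - s))}.
  by move=> cf; apply: (@continuous_comp _ _ _ (fun t => t - s) f);
    [apply: cvgB; [exact: cvg_id|exact: cvg_cst]|exact: cf].
apply: (@continuity_under_integral _ _ _ mu
  (fun t s => Re (h (- s)) * Re (h (t - s)) + Im (h (- s)) * Im (h (t - s)))
  `[al, be]%classic _ (-1) 1 _ _ (cst B)) => //.
- by move=> t _; exact: integrable_correlation.
- apply: nearW => s _ t _; apply: cvgD; apply: cvgM; try exact: cvg_cst.
  + exact: (shift _ _ _ cr).
  + exact: (shift _ _ _ ci).
- apply: continuous_compact_integrable; first exact: segment_compact.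
  by apply: continuous_subspaceT; exact: cst_continuous.
- move=> t; rewrite /= in_itv/= => /andP[t1 t2]; apply: nearW => s.
  rewrite /= in_itv/= => /andP[s1 s2].
  have q1 := cmax (- s); have q2 := cmax (t - s).
  rewrite !in_itv/= in q1 q2.
  have {}q1 := q1 ltac:(apply/andP; split; lra).
  have {}q2 := q2 ltac:(apply/andP; split; lra).
  rewrite -/B in q1 q2; move: q1 q2.
  move: (Re _) (Im _) (Re _) (Im _) => x1 y1 x2 y2 q1 q2.
  have := sqr_ge0 (x1 - x2); have := sqr_ge0 (x1 + x2).
  have := sqr_ge0 (y1 - y2); have := sqr_ge0 (y1 + y2).
  rewrite !sqrrB !sqrrD => *; rewrite ler_norml; apply/andP; split; lra.
- by rewrite inE /= in_itv/=; apply/andP; split; lra.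
Qed.

(** As [t] goes to 0 from below, the output at [t] of the matched input of norm 1
    tends to the square root of the left-hand side, and [ae_lt0_exists_near0]
    makes the essential supremum see these outputs.

    The operator [L] need only act as convolution with [h] at negative times, and
    on inputs supported in [[al, be]]: this is what survives when a causal filter
    is subtracted from the convolution filter of [h]. *)
Lemma op_norm_ge L h (al be : R) : al <= be -> cmeasurable h ->
  continuous (Re \o h) -> continuous (Im \o h) ->
  (forall x, Lp 2%:E x -> (forall s, s \notin `[al, be] -> x s = 0) ->
    \forall t \ae mu, t < 0 -> L x t = conv x h t) ->
  (\int[mu]_(s in `[al, be]) (nc (h (- s)%R) ^+ 2)%:E <= op_norm L * op_norm L)%E.
Proof.
move=> albe mh cr ci LE.
have cp : continuous (fun s => nc (h (- s)) ^+ 2).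
  under eq_fun do rewrite sqr_normc !expr2.
  by move=> t; apply: cvgD; apply: cvgM; first [exact: (continuous_opp cr)|exact: (continuous_opp ci)].
have Ip : mu.-integrable `[al, be] (fun s => (nc (h (- s)%R) ^+ 2)%:E).
  apply: continuous_compact_integrable; first exact: segment_compact.
  exact: continuous_subspaceT.
set E := (\int[mu]_(s in `[al, be]) nc (h (- s)) ^+ 2)%R.
have EE : (\int[mu]_(s in `[al, be]) (nc (h (- s)%R) ^+ 2)%:E)%E = E%:E.
  by rewrite /E /Rintegral fineK// integrable_fin_num.
have E_ge0 : 0 <= E by apply: Rintegral_ge0 => s _; exact: sqr_ge0.
rewrite EE; have [->|E0] := eqVneq E 0; first by rewrite mule_ge0 ?op_norm_ge0.
have {}E0 : 0 < E by rewrite lt_neqAle eq_sym E0.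
pose r := Num.sqrt E; have r0 : 0 < r by rewrite sqrtr_gt0.
have rr : r * r = E by rewrite -expr2 sqr_sqrtr.
pose x := restrict_signal `[al, be]%classic (matched_input r^-1 h).
have mm : cmeasurable (matched_input r^-1 h).
  have mN : measurable_fun [set: R] (fun s : R => - s) by exact: measurable_funN.
  have [hr hi] := cmeasurable_comp mh mN.
  split; first exact: measurable_funM.
  by apply: measurable_funN; exact: measurable_funM.
have nx : Lp_norm 2%:E x = 1%E.
  rewrite Lp_norm2E integral_sqr_restrict.
  have -> : (\int[mu]_(s in `[al, be]) (nc (matched_input r^-1 h s) ^+ 2)%:E =
     \int[mu]_(s in `[al, be]) ((E^-1)%:E * (nc (h (- s)%R) ^+ 2)%:E))%E.
    apply: eq_integral => s _; rewrite -EFinM; congr EFin.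
    rewrite !sqr_normc /= sqrrN !exprMn -mulrDr; congr (_ * _).
    by rewrite exprVn expr2 rr.
  by rewrite integralZl// EE -EFinM mulVf ?gt_eqF//= sqrtr1.
have Lx : Lp 2%:E x.
  by split; [exact: cmeasurable_restrict|rewrite nx ltry].
have rM : (r%:E <= Lp_norm +oo%E (L x))%E.
  rewrite leNgt; apply/negP => Mr.
  have Mfin : Lp_norm +oo%E (L x) \is a fin_num.
    by rewrite ge0_fin_numE ?Lp_norm_ge0// (lt_trans Mr)// ltry.
  have aeM : \forall t \ae mu, nc (L x t) <= fine (Lp_norm +oo%E (L x)).
    have := ess_sup_ge mu (fun t => (nc (L x t))%:E).
    by rewrite -Lp_normyE; apply: filterS => t; rewrite -lee_fin fineK.
  pose F t := \int[mu]_(s in `[al, be])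
    (Re (h (- s)) * Re (h (t - s)) + Im (h (- s)) * Im (h (t - s))).
  have F0 : F 0 = E.
    by apply: eq_Rintegral => s _; rewrite sub0r sqr_normc !expr2.
  (* The output at time [t] of the matched input is an autocorrelation of [h]. *)
  have FE t : Re (conv x h t) = r^-1 * F t.
    rewrite /F -RintegralZl//; last exact: integrable_correlation.
    rewrite Rintegral_mkcond; apply: eq_Rintegral => s _.
    rewrite patchE /x /restrict_signal; case: ifP => _; last by rewrite mul0r.
    rewrite Re_mul /=; ring.
  have : fine (Lp_norm +oo%E (L x)) < r^-1 * F 0.
    by rewrite F0 -rr mulKf ?gt_eqF// -lte_fin fineK.
  have cF : {for 0, continuous (fun t => r^-1 * F t)}.
    by apply: cvgMl_tmp; exact: continuous_correlation.
  move=> /(cvgr_gt _ cF)/nbhs_ballP[e /= e0 near0].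
  have aeP : \forall t \ae mu, t < 0 ->
      L x t = conv x h t /\ nc (L x t) <= fine (Lp_norm +oo%E (L x)).
    have LEx : \forall t \ae mu, t < 0 -> L x t = conv x h t.
      apply: LE => // s sD; rewrite /x /restrict_signal ifF//.
      by apply/negP; rewrite inE; exact/negP.
    have FF : Filter (almost_everywhere mu) by apply: ae_filter_ringOfSetsType.
    by apply: (@filterS2 _ _ FF _ _ _ _ LEx aeM) => t h1 h2 t0; split; [exact: h1|].
  have [t /andP[te t0] [Lt]] := ae_lt0_exists_near0 aeP e0.
  rewrite leNgt => /negP; apply.
  have : ball (0 : R) e t by rewrite /ball/= sub0r normrN ltr0_norm//; lra.
  move=> /near0 /= /lt_le_trans; apply.
  by rewrite -FE Lt (le_trans (ler_norm _))// normr_Re_le.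
apply: (@le_trans _ _ (r%:E * r%:E)%E); first by rewrite -EFinM rr.
have rN : (r%:E <= op_norm L)%E.
  by apply: le_trans rM _; apply: Lp_normy_le_op_norm => //; rewrite nx.
by apply: lee_pmul => //; rewrite lee_fin ltW.
Qed.

End LowerBound.


(** * Distance from the ideal filter to the causal filters *)

Section Distance.
Context {R : realType}.
Local Notation mu := (@lebesgue_measure R).
Local Notation nc := (@Normc.normc R).
Local Notation conv := (@Defs.conv R).
Implicit Types (x h : @signal R) (L : @operator R).

Lemma integral_bigcup_le (F : (set R)^nat) (f : R -> \bar R) (M : \bar R) :
  nondecreasing_seq F -> (forall n, measurable (F n)) ->
  measurable_fun setT f -> (forall t, 0 <= f t)%E ->
  (forall n, \int[mu]_(t in F n) f t <= M)%E ->
  (\int[mu]_(t in \bigcup_n F n) f t <= M)%E.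
Proof.
move=> ndF mF mf f0 FM.
have cvgF : ((\int[mu]_(t in F n) f t)%E @[n --> \oo] -->
    (\int[mu]_(t in \bigcup_n F n) f t)%E).
  by apply: ge0_nondecreasing_set_cvg_integral => // n; exact: measurable_funTS.
rewrite -(cvg_lim _ cvgF)//; apply: lime_le.
  by apply/cvg_ex; eexists; exact: cvgF.
exact: nearW.
Qed.

Lemma sqrtr_le_of_sqr_le (r : R) (N : \bar R) : (0 <= N)%E ->
  (r%:E <= N * N)%E -> ((Num.sqrt r)%:E <= N)%E.
Proof.
move=> N0 rN; rewrite -[leRHS]gee0_abs// -sqrte_sqr.
rewrite -[leLHS]/(sqrte r%:E) lee_sqrt ?expe2//.
by rewrite mule_ge0.
Qed.

Lemma ae_imply (P Q : R -> Prop) : (forall t, P t -> Q t) ->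
  (\forall t \ae mu, P t) -> \forall t \ae mu, Q t.
Proof.
have FF : Filter (almost_everywhere mu) by apply: ae_filter_ringOfSetsType.
by move=> PQ; apply: (@filterS _ _ FF).
Qed.

Lemma cintegral_ae0 x : cmeasurable x -> (\forall t \ae mu, x t = 0) ->
  cintegral setT x = 0.
Proof.
move=> [mr mi] x0; rewrite /cintegral.
have I0 (f : R -> R) : measurable_fun setT f -> (\forall t \ae mu, f t = 0) ->
    \int[mu]_t f t = 0.
  move=> mf f0; rewrite /Rintegral (ae_eq_integral (cst 0%E))//=.
  - by rewrite integral0.
  - exact/measurable_EFinP.
  - by apply: ae_imply f0 => t /= -> _.
by rewrite !I0//; apply: ae_imply x0 => t ->.
Qed.

(** For [t < 0] and [s >= 0] the time [t - s] is negative. *)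
Lemma conv_causal_lt0 x h t : cmeasurable x -> cmeasurable h ->
  (forall s, s < 0 -> x s = 0) -> (\forall s \ae mu, s < 0 -> h s = 0) ->
  t < 0 -> conv x h t = 0.
Proof.
move=> mx mh x0 h0 t0; apply: cintegral_ae0.
  apply: cmeasurableM => //; apply: cmeasurable_comp => //.
  by apply: measurable_funB => //; exact: measurable_cst.
apply: ae_imply (ae_reflect t h0) => s hs.
have [s0|s0] := ltP s 0; first by rewrite x0// mul0r.
by rewrite hs ?mulr0//; lra.
Qed.

Variables a b : R.
Hypothesis ab : a < b.
Local Notation h := (ideal_response a b).

Lemma op_norm_ideal_filter :
  op_norm (ideal_filter a b) = (Num.sqrt (b - a))%:E.
Proof.
apply/eqP; rewrite eq_le; apply/andP; split.
  rewrite -(Lp_norm2_ideal_response ab); apply: op_norm_le => //.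
  exact: L2_ideal_response.
apply: sqrtr_le_of_sqr_le; first exact: op_norm_ge0.
pose F (n : nat) := `[- n%:R, n%:R : R]%classic.
rewrite -(integral_sqr_ideal_response ab).
have <- : \bigcup_n F n = setT.
  apply/seteqP; split => // t _; exists (Num.bound `|t|) => //.
  by rewrite /F /= in_itv/= -ler_norml ltW// archi_boundP.
apply: integral_bigcup_le => //.
- apply/nondecreasing_seqP => n; rewrite subsetEset => t.
  rewrite /F /= !in_itv/= => /andP[h1 h2].
  by rewrite -natr1; apply/andP; split; lra.
- by move=> n; exact: measurable_itv.
- by apply: measurable_sqr_normc; exact: cmeasurable_ideal_response.
- by move=> t; rewrite lee_fin sqr_ge0.
- move=> n; under eq_integral => t _ do rewrite -(ideal_response_even ab t).
  apply: op_norm_ge.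
  + by rewrite -subr_ge0 opprK addr_ge0.
  + exact: cmeasurable_ideal_response.
  + exact: continuous_Re_ideal_response.
  + exact: continuous_Im_ideal_response.
  + by move=> x Lx _; apply: nearW.
Qed.

(** Inputs supported on [[0, n]] do not see a causal filter at negative times. *)
Lemma dist_causal_ge :
  ((Num.sqrt ((b - a) / 2))%:E <= dist (ideal_filter a b) causal_filters)%E.
Proof.
apply: le_ereal_inf_tmp => _ [K [_ [g [Lg g0 Kg]]] <-].
apply: sqrtr_le_of_sqr_le; first exact: op_norm_ge0.
pose F (n : nat) := `[0, n%:R : R]%classic.
rewrite -(integral_sqr_ideal_response_ge0 ab).
have <- : \bigcup_n F n = `[0, +oo[%classic.
  apply/seteqP; split => [t [n _]|t]; rewrite /F /= !in_itv/= andbT.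
    by case/andP.
  move=> t0; exists (Num.bound t) => //.
  by rewrite /F /= in_itv/= t0/= ltW// archi_boundP.
apply: integral_bigcup_le => //.
- apply/nondecreasing_seqP => n; rewrite subsetEset => t.
  rewrite /F /= !in_itv/= => /andP[h1 h2].
  by rewrite -natr1; apply/andP; split; lra.
- by move=> n; exact: measurable_itv.
- by apply: measurable_sqr_normc; exact: cmeasurable_ideal_response.
- by move=> t; rewrite lee_fin sqr_ge0.
- move=> n; under eq_integral => t _ do rewrite -(ideal_response_even ab t).
  apply: op_norm_ge.
  + by [].
  + exact: cmeasurable_ideal_response.
  + exact: continuous_Re_ideal_response.
  + exact: continuous_Im_ideal_response.
  + move=> x Lx x0; apply: ae_imply (Kg x Lx) => t -> t0.
    rewrite /conv_filter [X in _ - X]conv_causal_lt0 ?subr0//.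
    * by case: Lx.
    * by case: Lg.
    * move=> s s0; apply: x0; rewrite in_itv/= negb_and -ltNge s0//.
Qed.

(** The causal filter to compare with is given by the restriction of [h] to
    nonnegative times. *)
Lemma dist_causal_le :
  (dist (ideal_filter a b) causal_filters <= (Num.sqrt ((b - a) / 2))%:E)%E.
Proof.
have Lh := L2_ideal_response ab.
pose g := restrict_signal `[0, +oo[%classic h.
pose u := restrict_signal `]-oo, 0[%classic h.
have Lg : Lp 2%:E g by exact: L2_restrict.
have Lu : Lp 2%:E u by exact: L2_restrict.
have -> : (Num.sqrt ((b - a) / 2))%:E = Lp_norm 2%:E u.
  by rewrite Lp_norm2E integral_sqr_restrict integral_sqr_ideal_response_lt0.
have gu t : h t - g t = u t.
  rewrite /g /u /restrict_signal !mem_setE !in_itv/= andbT.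
  by case: ltP => _; rewrite ?subr0 ?subrr.
apply: (@le_trans _ _ (op_norm (fun x t => ideal_filter a b x t - conv_filter g x t))).
  apply: ereal_inf_lbound; exists (conv_filter g) => //.
  split; first exact: analog_conv_filter.
  exists g; split => //.
  - apply: nearW => t t0; by rewrite /g /restrict_signal mem_setE in_itv/= andbT leNgt t0.
  - by move=> x Lx; apply: nearW.
apply: op_norm_le => // x t Lx.
rewrite /ideal_filter /conv_filter conv_subr//.
by congr (Defs.conv x _ t); apply/funext => s; exact: gu.
Qed.

Lemma dist_causal : dist (ideal_filter a b) causal_filters = (Num.sqrt ((b - a) / 2))%:E.
Proof. by apply/eqP; rewrite eq_le dist_causal_le dist_causal_ge. Qed.

Lemma sin_piquarter : sin (pi / 4) = (Num.sqrt 2)^-1 :> R.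
Proof.
have p0 := pi_gt0 R.
have s0 : 0 <= sin (pi / 4) :> R by apply: sin_ge0_pi; lra.
apply: (@pexpIrn _ 2) => //; rewrite ?nnegrE ?invr_ge0 ?sqrtr_ge0//.
rewrite exprVn sqr_sqrtr//.
have := cos_mulr2n (pi / 4 : R).
have -> : (pi / 4) *+ 2 = pi / 2 :> R by rewrite mulr2n; field.
by rewrite cos_pihalf cos2sin2; lra.
Qed.

Lemma asin_invr_sqrt2 : asin (Num.sqrt 2)^-1 = pi / 4 :> R.
Proof.
have p0 := pi_gt0 R.
by rewrite -sin_piquarter sinK// in_itv/=; apply/andP; split; lra.
Qed.

Lemma sqrtr_half (r : R) : 0 <= r -> Num.sqrt (r / 2) = (Num.sqrt 2)^-1 * Num.sqrt r.
Proof. by move=> r0; rewrite sqrtrM// sqrtrV// mulrC. Qed.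

End Distance.

Theorem theorem3 (R : realType) (a b : R) (hab : a < b) :
  analog_filter (ideal_filter a b) /\
  angle (ideal_filter a b) causal_filters = pi / 4 /\
  dist (ideal_filter a b) causal_filters = (Num.sqrt ((b - a) / 2))%:E /\
  ((Num.sqrt ((b - a) / 2))%:E =
     ((Num.sqrt 2)^-1)%:E * op_norm (ideal_filter a b))%E.
Proof.
have s0 : 0 < Num.sqrt (b - a) by rewrite sqrtr_gt0 subr_gt0.
have half : Num.sqrt ((b - a) / 2) = (Num.sqrt 2)^-1 * Num.sqrt (b - a).
  by rewrite sqrtr_half// subr_ge0 ltW.
split; first exact/analog_conv_filter/L2_ideal_response.
split.
  rewrite /angle dist_causal// op_norm_ideal_filter//= half mulfK ?gt_eqF//.
  exact: asin_invr_sqrt2.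
by rewrite dist_causal// op_norm_ideal_filter// half EFinM.
Qed.
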